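(* Let $n\ge 2$ be an integer. There is a bijection between maximum obtuse almost-equiangular subsets of $S^{n-1}$ up to orthogonal transformations and $2(n+1)\times 2(n+1)$ symmetric, orthogonal matrices $O$ such that (1) $Oe=e$; (2) $O_{ii}=0$ for all $i$; (3) $O_{ij}O_{jk}O_{ki}=0$ for all $i$, $j$, and $k$. Here, $e$ is the all-ones vector.
   Context: $S^{n-1}=\{x\in\mathbb{R}^n:\|x\|=1\}$ is the $(n-1)$-dimensional unit sphere and $x\cdot y$ is the Euclidean inner product. For $t\in[-1,1)$, a set $S\subseteq S^{n-1}$ is $t$-almost-equiangular if every $3$-subset $\{x,y,z\}$ of $S$ is such that $t\in\{x\cdot y,\,x\cdot z,\,y\cdot z\}$. The maximum cardinality of a $t$-almost-equiangular set in $S^{n-1}$ with $t\le 0$ is at most $2(n+1)$, with equality only at $t=-1/n$; a maximum obtuse almost-equiangular subset of $S^{n-1}$ is a $(-1/n)$-almost-equiangular subset of $S^{n-1}$ with $2(n+1)$ points. *)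

(* Defs.v *)
From HB Require Import structures.
From mathcomp Require Import all_boot all_order all_algebra perm.
From mathcomp Require Import boolp classical_sets functions cardinality reals.

Set Implicit Arguments.
Unset Strict Implicit.
Unset Printing Implicit Defensive.

Import Order.TTheory GRing.Theory Num.Theory.

Local Open Scope classical_set_scope.
Local Open Scope ring_scope.

Section Geometry.
Variables (R : realType) (n : nat).
Implicit Types (u v : 'rV[R]_n) (t : R) (S T : set 'rV[R]_n) (Q : 'M[R]_n).

Definition dot u v : R := \sum_(i < n) u 0 i * v 0 i.

(* The Euclidean norm; the library's norm on matrices is the sup norm. *)
Definition enorm u : R := Num.sqrt (dot u u).

Definition sphere : set 'rV[R]_n := [set u | enorm u = 1].

Definition almost_equiangular t S : Prop :=
  S `<=` sphere /\
  forall x y z, S x -> S y -> S z -> x <> y -> x <> z -> y <> z ->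
    [\/ t = dot x y, t = dot x z | t = dot y z].

Definition max_obtuse S : Prop :=
  almost_equiangular (- n%:R^-1) S /\ (S #= `I_(2 * n.+1))%card.

Definition orthogonal_mx m (Q : 'M[R]_m) : Prop := Q^T *m Q = 1%:M.

(* All images of S under orthogonal transformations, which act on row vectors
   by right multiplication. *)
Definition orth_orbit S : set (set 'rV[R]_n) :=
  [set T | exists2 Q : 'M[R]_n, orthogonal_mx Q & T = (fun u => u *m Q) @` S].

Definition max_obtuse_orbits : set (set (set 'rV[R]_n)) :=
  orth_orbit @` [set S | max_obtuse S].

Definition enumerates N (x : 'I_N -> 'rV[R]_n) S : Prop := set_bij setT S x.

(* n/(n+1) G + 1/(n+1) J - I, with G the Gram matrix of x and J the all-ones
   matrix: the inner products 1 and -1/n become 1 and 0 off the diagonal, and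
   the diagonal of G becomes 0. *)
Definition assoc_mx N (x : 'I_N -> 'rV[R]_n) : 'M[R]_N :=
  (n%:R / n.+1%:R) *: (\matrix_(i, j) dot (x i) (x j))
  + n.+1%:R^-1 *: const_mx 1 - 1%:M.

End Geometry.

Section Matrices.
Variables (R : realType) (N : nat).
Implicit Types O : 'M[R]_N.

Definition ones : 'cV[R]_N := const_mx 1.

Definition admissible O : Prop :=
  [/\ O^T = O, orthogonal_mx O &
    [/\ O *m ones = ones,
        forall i, O i i = 0 &
        forall i j k, O i j * O j k * O k i = 0]].

(* All matrices obtained from O by simultaneously permuting rows and columns. *)
Definition perm_class O : set 'M[R]_N :=
  [set P | exists s : 'S_N, P = row_perm s (col_perm s O)].

End Matrices.

(* Main.v *)
Require Import Defs.
From HB Require Import structures.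
From mathcomp Require Import all_boot all_order all_algebra perm.
From mathcomp Require Import boolp classical_sets functions cardinality reals.
From mathcomp Require Import ring lra.

Import Order.TTheory GRing.Theory Num.Theory.

Local Open Scope classical_set_scope.
Local Open Scope ring_scope.

(** Let x enumerate a maximum obtuse set, let M be its associated matrix and let
    e be the all-ones vector.  By construction
    M + 1 = n/(n+1) X X^T + 1/(n+1) e e^T = B B^T, where the rows of X are the
    points and B has n + 1 columns.  Almost-equiangularity says that the triple
    products M_ij M_jk M_ki vanish, and M has zero diagonal, so
    tr M = tr M^3 = 0.  With K = B^T B this reads
    tr ((K - 2) K (K - 2)) + tr ((K - 2)^2) = 0, a sum of two nonnegative terms,
    hence K = 2 (frame_operator_eq2, equiangular_frame).  From K = 2 one gets
    that M is orthogonal and fixes e (assoc_mx_frame), so that M is admissible;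
    it has no entry 1 because the points are distinct.

    Conversely, for an admissible O the matrix (O + 1 - e e^T/(n+1))/2 is an
    orthogonal projection of trace n; it factors as Y Y^T with n columns, and
    the rows of a multiple of Y have associated matrix O (realization).  They
    form a maximum obtuse set when O has no entry 1 (max_obtuse_assoc).

    Renumbering the points permutes rows and columns of M, and orthogonal maps
    leave M unchanged.  Conversely M determines the Gram matrix and, because
    X^T X is a scalar matrix, the points up to an explicit orthogonal map
    (orth_orbit_perm_class).  So orbits correspond bijectively to permutation
    classes of admissible matrices without entry 1 (orbit_class_bij).

    A bijection from the orbits onto the admissible matrices themselves is then
    obtained from Cantor-Bernstein.  Orbits inject into admissible matrices by
    picking a representative of each class.  In the other direction, matrices
    inject into sets of natural numbers by Dedekind cuts, sets of natural
    numbers inject into ]0, 1] by ternary expansions, and ]0, 1] injects into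
    the classes by means of a one-parameter family of block matrices with
    off-diagonal blocks A and A^T, where A is a Householder reflection fixing e
    and the parameter is read off from the largest entry
    (card_itv_le_perm_classes). *)

(** * Traces and orthogonal projections *)

Section LinearAlgebra.
Context {R : realType}.

Lemma trmxZ m p (a : R) (A : 'M[R]_(m, p)) : (a *: A)^T = a *: A^T.
Proof. by apply/matrixP => i j; rewrite !mxE. Qed.

Lemma mxtrace_trmulE m p (A : 'M[R]_(m, p)) :
  \tr (A^T *m A) = \sum_i \sum_j A j i ^+ 2.
Proof.
rewrite /mxtrace; apply: eq_bigr => i _; rewrite mxE.
by apply: eq_bigr => j _; rewrite mxE expr2.
Qed.

Lemma mxtrace_trmul_ge0 m p (A : 'M[R]_(m, p)) : 0 <= \tr (A^T *m A).
Proof.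
rewrite mxtrace_trmulE; apply: sumr_ge0 => i _; apply: sumr_ge0 => j _.
exact: sqr_ge0.
Qed.

Lemma mxtrace_trmul_eq0 m p (A : 'M[R]_(m, p)) : \tr (A^T *m A) = 0 -> A = 0.
Proof.
rewrite mxtrace_trmulE => /psumr_eq0P A0; apply/matrixP => j i; rewrite mxE.
have /psumr_eq0P Ai0 := A0 (fun i _ => sumr_ge0 _ (fun j _ => sqr_ge0 _)) i isT.
by apply/eqP; rewrite -sqrf_eq0 Ai0 // => k _; exact: sqr_ge0.
Qed.

(** With K = B^T B, cyclicity of the trace turns the two conditions on
    M = B B^T - 1 into tr K = 2 d and tr K^3 = 3 tr K^2 - 4 d.  They say that
    tr ((K - 2)^2 (K + 1)) = 0, that is,
    tr ((K - 2) K (K - 2)) + tr ((K - 2)^2) = 0.  Since K = B^T B, both terms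
    are squared Frobenius norms, and the second forces K = 2.  On the
    eigenvalues t >= -1 of M this is the identity
    t^3 - 3 t + 2 = (t - 1)^2 (t + 2). *)
Lemma frame_operator_eq2 (N d : nat) (B : 'M[R]_(N, d)) (M : 'M[R]_N) :
  N = (2 * d)%N -> M = B *m B^T - 1%:M -> \tr M = 0 -> \tr (M *m M *m M) = 0 ->
  B^T *m B = 2%:M.
Proof.
move=> eN eM trM trM3; set K := B^T *m B.
have KT : K^T = K by rewrite trmx_mul trmxK.
have trP : \tr (B *m B^T) = \tr K by rewrite mxtrace_mulC.
have trP2 : \tr (B *m B^T *m (B *m B^T)) = \tr (K *m K).
  by rewrite mxtrace_mulC -mulmxA mxtrace_mulC !mulmxA.
have trP3 : \tr (B *m B^T *m (B *m B^T) *m (B *m B^T)) = \tr (K *m K *m K).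
  by rewrite -!mulmxA mxtrace_mulC !mulmxA.
have trK : \tr K = N%:R.
  move: trM; rewrite eM raddfB /= mxtrace1 trP => /eqP.
  by rewrite subr_eq0 => /eqP.
have trK3 : \tr (K *m K *m K) = \tr (K *m K) *+ 3 - N%:R *+ 2.
  move: trM3; rewrite eM !(mulmxBl, mulmxBr, mul1mx, mulmx1) !raddfB /=.
  rewrite trP3 trP2 trP mxtrace1 trK => e; apply/eqP; rewrite -subr_eq0.
  rewrite -{}e; apply/eqP; ring.
pose L := K - 2%:M.
have LT : L^T = L by rewrite linearB /= KT tr_scalar_mx.
have : \tr ((B *m L)^T *m (B *m L)) + \tr (L^T *m L) = 0.
  rewrite trmx_mul LT -mulmxA (mulmxA B^T) -/K.
  rewrite !(mulmxBl, mulmxBr) !mul_scalar_mx !mul_mx_scalar !raddfB /=.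
  rewrite -!scalemxAr !mxtraceZ mulmxA trK3 mxtrace_scalar trK eN natrM. ring.
have := mxtrace_trmul_ge0 _ _ (B *m L); have := mxtrace_trmul_ge0 _ _ L.
move=> h1 h2 h3; apply/eqP; rewrite -subr_eq0; apply/eqP.
apply: mxtrace_trmul_eq0; rewrite -/L; lra.
Qed.

(** An orthogonal projection splits off the line through any of its nonzero
    columns: such a column v, normalized, satisfies E v = v, and E - v v^T is
    again an orthogonal projection, of trace one less.  The normalized columns
    collected on the way form Y. *)
Lemma idempotent_factor m r (E : 'M[R]_m) :
  E^T = E -> E *m E = E -> \tr E = r%:R ->
  exists Y : 'M[R]_(m, r), E = Y *m Y^T.
Proof.
elim: r E => [|r IH] E ET EE trE.
  exists 0; rewrite mul0mx; apply: mxtrace_trmul_eq0.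
  by rewrite ET EE trE.
have diagE i : E i i = \sum_j E j i ^+ 2.
  rewrite -{1}EE mxE; apply: eq_bigr => j _.
  by rewrite -{1}ET mxE expr2.
(* The diagonal entries are squared column norms and their sum is positive. *)
have [i Eii] : exists i, 0 < E i i.
  apply: contrapT => /forallNP E0; move: trE.
  rewrite /mxtrace big1 => [/esym/eqP|i _].
    by rewrite pnatr_eq0.
  apply/eqP; move/negP: (E0 i); rewrite -leNgt eq_le => -> /=.
  by rewrite diagE sumr_ge0 // => j _; exact: sqr_ge0.
pose v := (Num.sqrt (E i i))^-1 *: col i E.
have Ecol : E *m col i E = col i E by rewrite colE mulmxA EE.
have Ev : E *m v = v by rewrite -scalemxAr Ecol.
have vE : v^T *m E = v^T by rewrite -{1}ET -trmx_mul Ev.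
have vv : v^T *m v = 1%:M.
  have -> : v^T = (Num.sqrt (E i i))^-1 *: row i E.
    by rewrite linearZ /= tr_col ET.
  apply/matrixP => a b; rewrite !ord1 /v -scalemxAl -scalemxAr -row_mul Ecol.
  by rewrite !mxE mulrA -invfM -expr2 sqr_sqrtr ?(ltW Eii) // mulVf // gt_eqF.
have [|||Y eY] := IH (E - v *m v^T).
- by rewrite linearB /= trmx_mul trmxK ET.
- rewrite mulmxBl !mulmxBr EE mulmxA Ev -(mulmxA v) vE mulmxA.
  rewrite -(mulmxA v _ v) vv.
  by rewrite mulmx1 subrr subr0.
- by rewrite linearB /= mxtrace_mulC vv mxtrace1 trE -natr1 addrK.
have eE : E = row_mx v Y *m (row_mx v Y)^T.
  by rewrite tr_row_mx mul_row_col -eY addrC subrK.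
by exists (row_mx v Y).
Qed.

End LinearAlgebra.

(** * The associated matrix of a configuration *)

Section Configurations.
Context {R : realType} {n : nat}.
Hypothesis n_gt0 : (0 < n)%N.
Let N := (2 * n.+1)%N.

Let nR_gt0 : 0 < n%:R :> R. Proof. by rewrite ltr0n. Qed.
Let nR_neq0 : n%:R != 0 :> R. Proof. by rewrite gt_eqF. Qed.
Let NRE : N%:R = 2 * n.+1%:R :> R. Proof. by rewrite natrM. Qed.
Let D1n_neq0 : 1 + n%:R != 0 :> R.
Proof. by rewrite addrC natr1 pnatr_eq0. Qed.

Lemma sphereE (u : 'rV[R]_n) : sphere u <-> dot u u = 1.
Proof.
rewrite /sphere /enorm /=; split => [u1|->]; last exact: sqrtr1.
rewrite -[LHS]sqr_sqrtr ?u1 ?expr1n //.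
by apply: sumr_ge0 => i _; rewrite -expr2 sqr_ge0.
Qed.

(** The equality case of Cauchy-Schwarz: the squared distance of the two points
    is 1 + 1 - 2 = 0. *)
Lemma unit_dot1_eq (u v : 'rV[R]_n) :
  dot u u = 1 -> dot v v = 1 -> dot u v = 1 -> u = v.
Proof.
move=> u1 v1 uv1; have /psumr_eq0P h : \sum_i (u 0 i - v 0 i) ^+ 2 = 0.
  transitivity (dot u u + dot v v - 2 * dot u v).
    rewrite /dot mulr_sumr -big_split -sumrB /=; apply: eq_bigr => i _; ring.
  by rewrite u1 v1 uv1; ring.
apply/rowP => i; apply/eqP; rewrite -subr_eq0 -sqrf_eq0 h // => j _.
exact: sqr_ge0.
Qed.

Lemma gram_mxE m (x : 'I_m -> 'rV[R]_n) :
  \matrix_(i, j) dot (x i) (x j) = (\matrix_i x i) *m (\matrix_i x i)^T.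
Proof.
by apply/matrixP => i j; rewrite !mxE; apply: eq_bigr => k _; rewrite !mxE.
Qed.

Lemma assoc_mx_entry m (x : 'I_m -> 'rV[R]_n) i j :
  assoc_mx x i j = n%:R / n.+1%:R * dot (x i) (x j) + n.+1%:R^-1 - (i == j)%:R.
Proof. by rewrite !mxE mulr1. Qed.

Lemma assoc_mx_diag m (x : 'I_m -> 'rV[R]_n) i :
  assoc_mx x i i = 0 <-> dot (x i) (x i) = 1.
Proof.
rewrite assoc_mx_entry eqxx mulr1n; split => [h|->].
  have -> : dot (x i) (x i) = 1 + n.+1%:R / n%:R *
      (n%:R / n.+1%:R * dot (x i) (x i) + n.+1%:R^-1 - 1).
    by field; rewrite nR_neq0 D1n_neq0.
  by rewrite h mulr0 addr0.
by field; rewrite D1n_neq0.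
Qed.

Lemma assoc_mx_eq0 m (x : 'I_m -> 'rV[R]_n) i j : i != j ->
  assoc_mx x i j = 0 <-> - n%:R^-1 = dot (x i) (x j).
Proof.
move=> /negPf ij; rewrite assoc_mx_entry ij subr0; split => [h|<-].
  have -> : dot (x i) (x j) = n.+1%:R / n%:R *
      (n%:R / n.+1%:R * dot (x i) (x j) + n.+1%:R^-1) - n%:R^-1.
    by field; rewrite nR_neq0 D1n_neq0.
  by rewrite h mulr0 add0r.
by field; rewrite nR_neq0 D1n_neq0.
Qed.

Lemma assoc_mx_eq1 m (x : 'I_m -> 'rV[R]_n) i j : i != j ->
  assoc_mx x i j = 1 <-> dot (x i) (x j) = 1.
Proof.
move=> /negPf ij; rewrite assoc_mx_entry ij subr0; split => [h|->].
  have -> : dot (x i) (x j) = 1 + n.+1%:R / n%:R *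
      (n%:R / n.+1%:R * dot (x i) (x j) + n.+1%:R^-1 - 1).
    by field; rewrite nR_neq0 D1n_neq0.
  by rewrite h subrr mulr0 addr0.
by field; rewrite D1n_neq0.
Qed.

Lemma assoc_mxE (x : 'I_N -> 'rV[R]_n) (X := \matrix_i x i) (e := @ones R N) :
  assoc_mx x = (n%:R / n.+1%:R) *: (X *m X^T) + n.+1%:R^-1 *: (e *m e^T) - 1%:M.
Proof.
rewrite /assoc_mx gram_mxE; congr (_ + _ *: _ - _).
by apply/matrixP => i j; rewrite !mxE big_ord1 !mxE mulr1.
Qed.

Lemma ones_dot : (@ones R N)^T *m @ones R N = N%:R%:M.
Proof.
apply/matrixP => i j; rewrite !mxE !ord1 eqxx (eq_bigr (fun=> 1)) => [|k _].
  by rewrite sumr_const card_ord.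
by rewrite !mxE mulr1.
Qed.

Lemma assoc_mx_tr (x : 'I_N -> 'rV[R]_n) : (assoc_mx x)^T = assoc_mx x.
Proof.
apply/matrixP => i j; rewrite mxE !assoc_mx_entry eq_sym; congr (_ * _ + _ - _).
by apply: eq_bigr => k _; rewrite mulrC.
Qed.

(** Stacking the coordinates of the points and a constant coordinate, suitably
    scaled, gives a matrix B with B B^T = assoc_mx x + 1.  The diagonal and the
    triple products make the traces of the associated matrix and of its cube
    vanish, so B^T B = 2; its blocks are the two conclusions.  This is where it
    matters that there are exactly 2 (n + 1) points, B having n + 1 columns. *)
Lemma equiangular_frame (x : 'I_N -> 'rV[R]_n) (X := \matrix_i x i) :
  (forall i, assoc_mx x i i = 0) ->
  (forall i j k, assoc_mx x i j * assoc_mx x j k * assoc_mx x k i = 0) ->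
  X^T *m X = (2 * n.+1%:R / n%:R)%:M /\ X^T *m @ones R N = 0.
Proof.
move=> diag0 triple0; set e := @ones R N.
set a : R := n%:R / n.+1%:R; set b : R := n.+1%:R^-1.
have a_gt0 : 0 < a by rewrite divr_gt0 // ltr0n.
have b_gt0 : 0 < b by rewrite invr_gt0 ltr0n.
pose B := row_mx (Num.sqrt a *: X) (Num.sqrt b *: e).
have BBT : assoc_mx x = B *m B^T - 1%:M.
  rewrite assoc_mxE tr_row_mx mul_row_col !trmxZ -!scalemxAl -!scalemxAr.
  by rewrite !scalerA -!expr2 !sqr_sqrtr ?ltW.
have trM : \tr (assoc_mx x) = 0 by apply: big1 => i _; exact: diag0.
have trM3 : \tr (assoc_mx x *m assoc_mx x *m assoc_mx x) = 0.
  apply: big1 => i _; rewrite mxE; apply: big1 => k _; rewrite mxE mulr_suml.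
  by apply: big1 => j _; exact: triple0.
have dimN : N = (2 * (n + 1))%N by rewrite /N addn1.
have := frame_operator_eq2 _ _ _ _ dimN BBT trM trM3.
rewrite tr_row_mx mul_col_row !trmxZ (scalar_mx_block n 1).
move=> /eq_block_mx[XX Xe _ _]; split.
  move: XX; rewrite -!scalemxAl -!scalemxAr scalerA -expr2 sqr_sqrtr ?ltW //.
  move=> /(congr1 ( *:%R a^-1)); rewrite scalerA mulVf ?gt_eqF // scale1r => ->.
  by rewrite scale_scalar_mx invf_div mulrC mulrA.
move: Xe; rewrite -!scalemxAl -!scalemxAr scalerA => /eqP.
by rewrite scaler_eq0 mulf_eq0 !sqrtr_eq0 !leNgt a_gt0 b_gt0 /= => /eqP.
Qed.

(** P = assoc_mx x + 1 has the columns of X and the vector e as eigenvectors for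
    the eigenvalue 2, and its columns are combinations of them, so P^2 = 2 P.
    This is the orthogonality of the symmetric matrix P - 1. *)
Lemma assoc_mx_frame (x : 'I_N -> 'rV[R]_n) (X := \matrix_i x i) :
  X^T *m X = (2 * n.+1%:R / n%:R)%:M -> X^T *m @ones R N = 0 ->
  orthogonal_mx (assoc_mx x) /\ assoc_mx x *m @ones R N = @ones R N.
Proof.
move=> XX Xe; set e := @ones R N in Xe *.
have eX : e^T *m X = 0 by rewrite -[LHS]trmxK trmx_mul trmxK Xe trmx0.
set P := assoc_mx x + 1%:M.
have PE : P = (n%:R / n.+1%:R) *: (X *m X^T) + n.+1%:R^-1 *: (e *m e^T).
  by rewrite /P assoc_mxE subrK.
have PX : P *m X = 2 *: X.
  rewrite PE mulmxDl -!scalemxAl -!mulmxA XX eX mulmx0 scaler0 addr0.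
  rewrite mul_mx_scalar scalerA; congr (_ *: _); field.
  by rewrite nR_neq0 D1n_neq0.
have Pe : P *m e = 2 *: e.
  rewrite PE mulmxDl -!scalemxAl -!mulmxA Xe mulmx0 scaler0 add0r.
  rewrite ones_dot mul_mx_scalar scalerA NRE; congr (_ *: _); field.
  by rewrite D1n_neq0.
have PP : P *m P = 2 *: P.
  rewrite {2}PE mulmxDr -!scalemxAr !mulmxA PX Pe -!scalemxAl.
  by rewrite [in RHS]PE scalerDr !scalerA ![2 * _]mulrC.
have MP : assoc_mx x = P - 1%:M by rewrite addrK.
split.
  rewrite /orthogonal_mx assoc_mx_tr MP !(mulmxBl, mulmxBr) PP !mulmx1 mul1mx.
  by rewrite scaler_nat mulr2n [P + P - P]addrK opprB addrC subrK.
by rewrite MP mulmxBl Pe mul1mx scaler_nat mulr2n addrK.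
Qed.

(** O + 1 is twice an orthogonal projection fixing e.  Removing the direction of
    e leaves twice a projection of trace n, and the rows of a factor of that
    projection with n columns are the points, up to a common scale. *)
Lemma realization (O : 'M[R]_N) :
  O^T = O -> orthogonal_mx O -> O *m @ones R N = @ones R N ->
  (forall i, O i i = 0) -> exists x : 'I_N -> 'rV[R]_n, assoc_mx x = O.
Proof.
move=> OT OO Oe diag0; set e := @ones R N in Oe *.
have {}OO : O *m O = 1%:M by rewrite -{1}OT.
have eO : e^T *m O = e^T by rewrite -{1}OT -trmx_mul Oe.
have n2 : 2 != 0 :> R by rewrite pnatr_eq0.
pose J := n.+1%:R^-1 *: (e *m e^T).
have OJ : O *m J = J by rewrite -scalemxAr mulmxA Oe.
have JO : J *m O = J by rewrite -scalemxAl -mulmxA eO.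
have JJ : J *m J = 2 *: J.
  rewrite -scalemxAl -scalemxAr mulmxA -(mulmxA e) ones_dot mul_mx_scalar.
  rewrite -scalemxAl !scalerA NRE; congr (_ *: _); field; exact: D1n_neq0.
pose D := O + 1%:M - J.
have DD : D *m D = 2 *: D.
  rewrite /D !(mulmxBl, mulmxBr, mulmxDl, mulmxDr) OO OJ JO JJ !mulmx1 !mul1mx.
  apply/matrixP => i j; rewrite !mxE; ring.
have DT : D^T = D.
  by rewrite /D !linearB !linearD /= OT trmx1 /J trmxZ trmx_mul trmxK.
have [|||Y eY] := @idempotent_factor R N n (2^-1 *: D).
- by rewrite trmxZ DT.
- by rewrite -scalemxAl -scalemxAr DD !scalerA -mulrA mulVf ?mulr1.
- rewrite mxtraceZ /D raddfB raddfD /= mxtrace1 {1}/mxtrace big1 // add0r.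
  rewrite mxtraceZ.
  rewrite mxtrace_mulC ones_dot mxtrace_scalar mulr1n NRE.
  by field; rewrite D1n_neq0.
exists (fun i => row i (Num.sqrt (2 * n.+1%:R / n%:R) *: Y)).
rewrite assoc_mxE; set X := \matrix_i _.
have -> : X = Num.sqrt (2 * n.+1%:R / n%:R) *: Y.
  by apply/row_matrixP => i; rewrite rowK.
rewrite trmxZ -scalemxAl -scalemxAr (scalerA (Num.sqrt _)) -expr2 sqr_sqrtr.
  rewrite -eY !scalerA -/e -/J (_ : _ * _ * _ = 1).
    by rewrite scale1r /D subrK addrK.
  by field; rewrite nR_neq0 D1n_neq0.
by rewrite divr_ge0 ?mulr_ge0 ?ler0n.
Qed.

End Configurations.

(** * Permutation classes and orthogonal orbits *)

(** The element u0 serves as the value of the bijection outside A. *)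
Lemma card_eq_set_bij T U (u0 : U) (A : set T) (B : set U) :
  (A #= B)%card <-> exists f : T -> U, set_bij A B f.
Proof.
elim/Ppointed: U => U in u0 B *; first by case: (no u0).
by split=> /card_set_bijP.
Qed.

Section PermClass.
Context {R : realType} {N : nat}.
Implicit Types O P : 'M[R]_N.

Lemma mem_perm_classP O P :
  perm_class O P <-> exists s : 'S_N, forall i j, P i j = O (s i) (s j).
Proof.
split=> [[s ->]|[s PE]]; exists s; first by move=> i j; rewrite !mxE.
by apply/matrixP => i j; rewrite !mxE PE.
Qed.

Lemma perm_class_refl O : perm_class O O.
Proof. by apply/mem_perm_classP; exists 1%g => i j; rewrite !perm1. Qed.

Lemma perm_class_eqP O P : perm_class O = perm_class P <-> perm_class O P.
Proof.
split=> [->|/mem_perm_classP[s PE]]; first exact: perm_class_refl.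
apply/seteqP; split => Q /mem_perm_classP[t QE]; apply/mem_perm_classP.
  by exists (t * s^-1)%g => i j; rewrite PE QE !permM !permKV.
by exists (t * s)%g => i j; rewrite QE PE !permM.
Qed.

End PermClass.

Section Orbits.
Context {R : realType} {n : nat}.
Implicit Types (S T : set 'rV[R]_n) (Q : 'M[R]_n).

Lemma orthogonal_mulmxT Q : orthogonal_mx Q -> Q *m Q^T = 1%:M.
Proof. exact: mulmx1C. Qed.

Lemma dot_orthogonal Q (u v : 'rV[R]_n) :
  orthogonal_mx Q -> dot (u *m Q) (v *m Q) = dot u v.
Proof.
have dotE (a b : 'rV[R]_n) : dot a b = (a *m b^T) 0 0.
  by rewrite mxE; apply: eq_bigr => i _; rewrite mxE.
move=> /orthogonal_mulmxT QQ.
by rewrite !dotE trmx_mul mulmxA -(mulmxA u) QQ mulmx1.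
Qed.

Lemma orth_orbit_refl S : orth_orbit S S.
Proof.
exists 1%:M; first by rewrite /orthogonal_mx trmx1 mulmx1.
rewrite (_ : (fun u => _) = id) ?image_id //; apply/funext => u.
by rewrite mulmx1.
Qed.

Lemma orth_orbit_eqP S T : orth_orbit S = orth_orbit T <-> orth_orbit S T.
Proof.
split=> [->|[Q QO ->]]; first exact: orth_orbit_refl.
have orthM (A B : 'M[R]_n) :
    orthogonal_mx A -> orthogonal_mx B -> orthogonal_mx (A *m B).
  move=> AO BO.
  by rewrite /orthogonal_mx trmx_mul mulmxA -(mulmxA B^T) AO mulmx1.
have QTO : orthogonal_mx Q^T.
  by rewrite /orthogonal_mx trmxK orthogonal_mulmxT.
apply/seteqP; split => _ [P PO ->].
  exists (Q^T *m P); first exact: orthM.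
  rewrite image_comp; congr (_ @` _).
  apply/funext => u /=.
  by rewrite -!mulmxA (mulmxA Q) orthogonal_mulmxT // mul1mx.
exists (Q *m P); first exact: orthM.
rewrite image_comp; congr (_ @` _).
by apply/funext => u /=; rewrite mulmxA.
Qed.


Lemma assoc_mx_perm m (x : 'I_m -> 'rV[R]_n) (s : 'S_m) i j :
  assoc_mx (x \o s) i j = assoc_mx x (s i) (s j).
Proof. by rewrite !assoc_mx_entry (inj_eq perm_inj). Qed.

Lemma assoc_mx_orthogonal m (x : 'I_m -> 'rV[R]_n) Q :
  orthogonal_mx Q -> assoc_mx (fun i => x i *m Q) = assoc_mx x.
Proof.
move=> QO; apply/matrixP => i j.
by rewrite !assoc_mx_entry dot_orthogonal.
Qed.

Lemma enumeratesP m (x : 'I_m -> 'rV[R]_n) S :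
  enumerates x S <-> injective x /\ S = range x.
Proof.
split=> [[xS xinj Sx]|[xinj ->]].
  split=> [i j xij|]; first by apply: xinj => //; rewrite inE.
  by apply/seteqP; split => // _ [i _ <-]; exact: xS.
by split=> // i j _ _; exact: xinj.
Qed.

Lemma card_enumerates m S :
  (S #= `I_m)%card <-> exists x : 'I_m -> 'rV[R]_n, enumerates x S.
Proof.
rewrite card_eq_sym (card_eql card_II).
exact: card_eq_set_bij (0 : 'rV_n) _ _.
Qed.

Lemma enumerates_perm m (x y : 'I_m -> 'rV[R]_n) S :
  enumerates x S -> enumerates y S -> exists s : 'S_m, y = x \o s.
Proof.
move=> /enumeratesP[xinj ->] /enumeratesP[yinj xy].
have /choice[f fE] : forall i, exists j, x j = y i.
  move=> i; have [j _ <-] : range x (y i) by rewrite xy; exists i.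
  by exists j.
have finj : injective f by move=> i j fij; apply: yinj; rewrite -!fE fij.
by exists (perm finj); apply/funext => i; rewrite /= permE fE.
Qed.

Lemma enumerates_orthogonal m (x : 'I_m -> 'rV[R]_n) S Q :
  orthogonal_mx Q -> enumerates x S ->
  enumerates (fun i => x i *m Q) ((fun u => u *m Q) @` S).
Proof.
move=> QO /enumeratesP[xinj ->]; apply/enumeratesP; split.
  move=> i j /(congr1 (mulmx^~ Q^T)).
  by rewrite -!mulmxA orthogonal_mulmxT // !mulmx1 => /xinj.
by rewrite image_comp.
Qed.

End Orbits.

(** * Maximum obtuse sets and admissible matrices *)

Section Correspondence.
Context {R : realType} {n : nat}.
Hypothesis n_gt0 : (0 < n)%N.
Let N := (2 * n.+1)%N.
Implicit Types (S T : set 'rV[R]_n).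

Lemma max_obtuse_enumerates S :
  max_obtuse S -> exists x : 'I_N -> 'rV[R]_n, enumerates x S.
Proof. by move=> [_ /card_enumerates]. Qed.

(** The frame identity is kept in the conclusion because it makes the
    configuration recoverable from its Gram matrix. *)
Lemma admissible_assoc S (x : 'I_N -> 'rV[R]_n) :
  max_obtuse S -> enumerates x S ->
  [/\ (\matrix_i x i)^T *m (\matrix_i x i) = (2 * n.+1%:R / n%:R)%:M,
      admissible (assoc_mx x) & forall i j, assoc_mx x i j <> 1].
Proof.
move=> [[Ssph Seq] _] /enumeratesP[xinj eS].
have xS i : S (x i) by rewrite eS; exists i.
have x1 i : dot (x i) (x i) = 1 by apply/sphereE/Ssph.
have diag0 i : assoc_mx x i i = 0 by apply/assoc_mx_diag.
have triple i j k : assoc_mx x i j * assoc_mx x j k * assoc_mx x k i = 0.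
  have sym a b : assoc_mx x a b = assoc_mx x b a by rewrite -{1}assoc_mx_tr mxE.
  have [->|ij] := eqVneq i j; first by rewrite diag0 !mul0r.
  have [->|jk] := eqVneq j k; first by rewrite diag0 mulr0 mul0r.
  have [->|ik] := eqVneq i k; first by rewrite diag0 mulr0.
  have xD a b : a != b -> x a <> x b by move=> /eqP ab /xinj.
  have [] := Seq _ _ _ (xS i) (xS j) (xS k) (xD _ _ ij) (xD _ _ ik) (xD _ _ jk).
  - by move=> /(assoc_mx_eq0 n_gt0 _ _ _ _ ij) ->; rewrite !mul0r.
  - move=> /(assoc_mx_eq0 n_gt0 _ _ _ _ ik).
    by rewrite sym => ->; rewrite mulr0.
  - by move=> /(assoc_mx_eq0 n_gt0 _ _ _ _ jk) ->; rewrite mulr0 mul0r.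
have [XX Xe] := equiangular_frame n_gt0 x diag0 triple.
have [MO Me] := assoc_mx_frame n_gt0 x XX Xe.
split=> //; first by split=> //; exact: assoc_mx_tr.
move=> i j; have [->|ij] := eqVneq i j.
  by rewrite diag0 => /eqP; rewrite eq_sym oner_eq0.
move=> /(assoc_mx_eq1 n_gt0 _ _ _ _ ij) /(unit_dot1_eq _ _ (x1 i) (x1 j)) /xinj.
exact/eqP.
Qed.

Lemma max_obtuse_assoc (x : 'I_N -> 'rV[R]_n) :
  admissible (assoc_mx x) -> (forall i j, assoc_mx x i j <> 1) ->
  max_obtuse (range x) /\ enumerates x (range x).
Proof.
move=> [_ _ [_ diag0 triple]] no1.
have x1 i : dot (x i) (x i) = 1 by apply/assoc_mx_diag.
have xinj : injective x.
  move=> i j xij; apply/eqP; apply/negPn/negP => ij; apply: (no1 i j).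
  by apply/assoc_mx_eq1 => //; rewrite xij.
have xS : enumerates x (range x) by apply/enumeratesP.
split=> //; split; last by apply/card_enumerates; exists x.
split=> [_ [i _ <-]|_ _ _ [i _ <-] [j _ <-] [k _ <-] ij ik jk].
  exact/sphereE.
have neq a b : x a <> x b -> a != b.
  by move=> ab; apply/eqP => e; apply: ab; rewrite e.
have /eqP := triple i j k; rewrite !mulf_eq0 => /orP[/orP[]|] /eqP.
- by move=> /(assoc_mx_eq0 n_gt0 _ _ _ _ (neq _ _ ij)); constructor 1.
- by move=> /(assoc_mx_eq0 n_gt0 _ _ _ _ (neq _ _ jk)); constructor 3.
- rewrite -{1}assoc_mx_tr mxE.
  by move=> /(assoc_mx_eq0 n_gt0 _ _ _ _ (neq _ _ ik)); constructor 2.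
Qed.

(** Two enumerations x and y with the same Gram matrix, with coordinate
    matrices X and Y, differ by an orthogonal Q.  As X^T X and Y^T Y are both
    the scalar c, the choice Q = c^-1 X^T Y works: X Q = c^-1 X X^T Y
    = c^-1 Y Y^T Y = Y, and Q^T Q = c^-1 Y^T X Q = c^-1 Y^T Y = 1. *)
Lemma orth_orbit_perm_class S T (x y : 'I_N -> 'rV[R]_n) :
  max_obtuse S -> max_obtuse T -> enumerates x S -> enumerates y T ->
  orth_orbit S = orth_orbit T <->
  perm_class (assoc_mx x) = perm_class (assoc_mx y).
Proof.
move=> mS mT xS yT; split.
  move=> /orth_orbit_eqP[Q QO eT]; apply/perm_class_eqP/mem_perm_classP.
  have := enumerates_orthogonal _ _ _ _ QO xS; rewrite -eT => xQ.
  have [s ->] := enumerates_perm _ _ _ _ xQ yT; exists s => i j.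
  by rewrite assoc_mx_perm assoc_mx_orthogonal.
move=> /perm_class_eqP/mem_perm_classP[s Es]; apply/orth_orbit_eqP.
(* Reordering x by s makes the two associated matrices equal. *)
have {}xS : enumerates (x \o s) S.
  have /enumeratesP[xinj ->] := xS; apply/enumeratesP.
  split; first exact: inj_comp xinj perm_inj.
  apply/seteqP; split => _ [i _ <-]; last by exists (s i).
  by exists ((s^-1)%g i) => //=; rewrite permKV.
have {}Es : assoc_mx (x \o s) = assoc_mx y.
  by apply/matrixP => i j; rewrite Es assoc_mx_perm.
move: (x \o s) xS Es => {s} {}x xS Es.
have [XX _ _] := admissible_assoc _ _ mS xS.
have [YY _ _] := admissible_assoc _ _ mT yT.
set X := \matrix_i x i in XX; set Y := \matrix_i y i in YY.
set c : R := 2 * n.+1%:R / n%:R in XX YY.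
have c0 : c != 0 by rewrite /c mulf_neq0 ?mulf_neq0 ?invr_eq0 ?pnatr_eq0 -?lt0n.
have XY : X *m X^T = Y *m Y^T.
  move: Es; rewrite !assoc_mxE => /addIr/addIr/scalerI; apply.
  by rewrite mulf_neq0 ?invr_eq0 ?pnatr_eq0 -?lt0n.
pose Q := c^-1 *: (X^T *m Y).
have XQ : X *m Q = Y.
  rewrite -scalemxAr mulmxA XY -mulmxA YY mul_mx_scalar scalerA mulVf //.
  by rewrite scale1r.
exists Q.
  rewrite /orthogonal_mx {1}/Q trmxZ trmx_mul trmxK -scalemxAl -mulmxA XQ YY.
  by rewrite scale_scalar_mx mulVf.
have /enumeratesP[_ ->] := xS; have /enumeratesP[_ ->] := yT.
rewrite image_comp; congr (_ @` _); apply/funext => i /=.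
by rewrite -[y i](rowK y) -[x i](rowK x) -/Y -XQ row_mul.
Qed.

End Correspondence.

(** The union of the classes of the associated matrices of all enumerations of
    all sets in the orbit; this avoids choosing a set and an enumeration. *)
Definition orbit_class {R : realType} {n : nat} (c : set (set 'rV[R]_n)) :
    set 'M[R]_(2 * n.+1) :=
  [set O | exists S x, [/\ max_obtuse S, enumerates x S, c = orth_orbit S &
                         perm_class (assoc_mx x) O]].

Lemma orbit_classE {R : realType} {n : nat} (S : set 'rV[R]_n) x :
  (0 < n)%N -> max_obtuse S -> enumerates x S ->
  orbit_class (orth_orbit S) = perm_class (assoc_mx x).
Proof.
move=> n_gt0 mS xS; apply/seteqP; split => [O [T [y [mT yT e yO]]]|O xO].
  by rewrite (orth_orbit_perm_class n_gt0 _ _ x y mS mT xS yT).1.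
by exists S, x.
Qed.

Lemma orbit_class_bij {R : realType} {n : nat} : (0 < n)%N ->
  set_bij (@max_obtuse_orbits R n)
    (@perm_class R (2 * n.+1) @`
       [set O | admissible O /\ forall i j, O i j <> 1]) orbit_class.
Proof.
move=> n_gt0; split.
- move=> _ [S mS <-]; have [x xS] := max_obtuse_enumerates _ mS.
  exists (assoc_mx x); last by rewrite (orbit_classE S x).
  by have [_ ? ?] := admissible_assoc n_gt0 _ _ mS xS.
- move=> c d /set_mem[S mS <-] /set_mem[T mT <-].
  have [x xS] := max_obtuse_enumerates _ mS.
  have [y yT] := max_obtuse_enumerates _ mT.
  rewrite (orbit_classE S x) // (orbit_classE T y) //.
  exact: (orth_orbit_perm_class n_gt0 _ _ x y mS mT xS yT).2.
- move=> _ [O [Oadm no1] <-]; have [OT OO [Oe diag0 _]] := Oadm.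
  have [x xO] := realization n_gt0 O OT OO Oe diag0.
  rewrite -{}xO in Oadm no1 *.
  have [mS xS] := max_obtuse_assoc n_gt0 x Oadm no1.
  by exists (orth_orbit (range x)); [exists (range x)|exact: orbit_classE].
Qed.

(** * Real matrices and the interval ]0, 1] *)

Lemma card_le_inj {T U} (A : set T) (B : set U) (f : T -> U) :
  set_fun A B f -> set_inj A f -> (A #<= B)%card.
Proof.
move=> fAB finj.
have /injfunPex[/inj_card_le //] : exists2 f, set_fun A B f & set_inj A f.
by exists f.
Qed.

Section Continuum.
Context {R : realType}.

(** A real matrix is determined by the rationals below each of its entries, and
    a triple of two indices and a rational can be coded by a natural number. *)
Lemma card_mx_le_set_nat m p : ([set: 'M[R]_(m, p)] #<= [set: set nat])%card.
Proof.
pose f (M : 'M[R]_(m, p)) := [set k : nat | exists i j (q : rat),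
  k = pickle (i, j, q) /\ ratr q < M i j].
apply: (card_le_inj _ _ f) => // M M' _ _ fMM'.
apply/matrixP => i j; apply/eqP/negPn/negP => ij.
wlog lt_ij : M M' fMM' ij / M i j < M' i j.
  move=> h; move: (ij); rewrite neq_lt => /orP[/h|/(h M')]; apply=> //.
  by rewrite eq_sym.
have [q /andP[]] := rat_in_itvoo lt_ij.
rewrite !bnd_simp => Mq qM'.
have : f M' (pickle (i, j, q)) by exists i, j, q.
rewrite -fMM' => -[i' [j' [q' [/(pcan_inj pickleK)[<- <- <-]]]]].
by rewrite ltNge (ltW Mq).
Qed.

Definition ternary_sum (A : set nat) (k : nat) : R :=
  \sum_(i < k) (`[< A i >])%:R / 3 ^+ i.+1.

Definition ternary (A : set nat) : R := sup (range (ternary_sum A)).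

Let ternary_sumS A k :
  ternary_sum A k.+1 = ternary_sum A k + (`[< A k >])%:R / 3 ^+ k.+1.
Proof. by rewrite /ternary_sum big_ord_recr. Qed.

Let pow3_gt0 k : 0 < (3 ^+ k)^-1 :> R.
Proof. by rewrite invr_gt0 exprn_gt0. Qed.

Let pow3S k : (3 ^+ k.+1)^-1 = (3 ^+ k)^-1 / 3 :> R.
Proof. by rewrite exprSr invfM. Qed.

(** Every partial sum lies below any other one increased by the largest possible
    remainder of the series after it, which is half of the last power of 1/3. *)
Lemma ternary_sum_bound A k l :
  ternary_sum A k <= ternary_sum A l + (3 ^+ l)^-1 / 2.
Proof.
have inc i j : (i <= j)%N -> ternary_sum A i <= ternary_sum A j.
  move=> /subnK <-; elim: (j - i)%N => // d IH.
  by rewrite addSn ternary_sumS (le_trans IH) // lerDl mulr_ge0 // ltW.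
have dec i j : (i <= j)%N ->
    ternary_sum A j + (3 ^+ j)^-1 / 2 <= ternary_sum A i + (3 ^+ i)^-1 / 2.
  move=> /subnK <-; elim: (j - i)%N => // d IH.
  rewrite addSn ternary_sumS (le_trans _ IH) // pow3S.
  have := pow3_gt0 (d + i); case: asboolP => _ /=; lra.
have := pow3_gt0 k; have := pow3_gt0 l.
have [/inc|/ltnW/dec] := leqP k l; lra.
Qed.

Lemma ternary_bounds A k :
  ternary_sum A k <= ternary A <= ternary_sum A k + (3 ^+ k)^-1 / 2.
Proof.
have ub l : ubound (range (ternary_sum A)) (ternary_sum A l + (3 ^+ l)^-1 / 2).
  by move=> _ [i _ <-]; exact: ternary_sum_bound.
apply/andP; split.
  by apply: ub_le_sup; [exists (ternary_sum A 0 + (3 ^+ 0)^-1 / 2) | exists k].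
by apply: ge_sup => //; exists (ternary_sum A 0); exists 0%N.
Qed.

(** At the first index k where two sets differ the partial sums part by
    3^-(k+1), and all later digits together contribute at most half of that. *)
Lemma ternary_inj : injective ternary.
Proof.
move=> A B AB; apply: contrapT => /eqP AneB.
have ex : exists k, `[< A k >] != `[< B k >].
  apply: contrapT => /forallNP h; move/negP: AneB; apply; apply/eqP.
  apply/funext => k; apply/propext; apply: asbool_eq_equiv.
  by move/negP/negPn/eqP: (h k).
have [k Ak kmin] := ex_minnP ex.
have eqk : ternary_sum A k = ternary_sum B k.
  apply: eq_bigr => i _; congr (_%:R / _); congr nat_of_bool.
  by apply/eqP/negPn/negP => /kmin; rewrite leqNgt ltn_ord.
have /andP[A1 A2] := ternary_bounds A k.+1.
have /andP[B1 B2] := ternary_bounds B k.+1.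
move: Ak A1 A2 B1 B2; rewrite !ternary_sumS -eqk AB.
have := pow3_gt0 k.+1; case: asboolP => _; case: asboolP => _ //= p _; lra.
Qed.

(** The ternary expansions lie in the interval [0, 1/2]; the shift by 1/2 keeps
    the values positive. *)
Lemma card_set_nat_le_itv :
  ([set: set nat] #<= [set s : R | 0 < s <= 1])%card.
Proof.
apply: (card_le_inj _ _ (fun A => ternary A + 2^-1)).
  move=> A _ /=; have /andP[] := ternary_bounds A 0.
  rewrite /ternary_sum big_ord0 expr0 invr1 => ? ?; apply/andP; split; lra.
by move=> A B _ _ /addIr/ternary_inj.
Qed.

End Continuum.

(** * A one-parameter family of permutation classes *)

Section Bipartite.
Context {R : realType}.

Definition max_entry {m} (O : 'M[R]_m) (a : R) :=
  (exists i j, O i j = a) /\ forall i j, O i j <= a.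

Lemma max_entry_perm_class m (O P : 'M[R]_m) a b :
  perm_class O P -> max_entry O a -> max_entry P b -> a = b.
Proof.
move=> /mem_perm_classP[s PE] [[i [j <-]] Ole] [[i' [j' <-]] Ple].
apply/le_anti/andP; split; last by rewrite PE Ole.
by rewrite -[i](permKV s) -[j](permKV s) -PE Ple.
Qed.

(** The triple products vanish because a bipartite graph has no triangle.  The
    geometric counterpart is a union of two regular simplices. *)
Lemma bipartite_admissible d (A : 'M[R]_d) :
  orthogonal_mx A -> A *m @ones R d = @ones R d ->
  admissible (block_mx 0 A A^T 0).
Proof.
move=> AO Ae; have AO' : A *m A^T = 1%:M by exact: mulmx1C.
have ATe : A^T *m @ones R d = @ones R d by rewrite -{1}Ae mulmxA AO mul1mx.
have sym : (block_mx 0 A A^T 0)^T = block_mx 0 A A^T 0.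
  by rewrite tr_block_mx !trmx0 trmxK.
split=> //.
  rewrite /orthogonal_mx sym mulmx_block !(mul0mx, mulmx0, addr0, add0r).
  by rewrite AO AO' -scalar_mx_block.
split=> [|i|i j k].
- have -> : @ones R (d + d) = col_mx (@ones R d) (@ones R d).
    by rewrite col_mx_const.
  by rewrite mul_block_col !mul0mx add0r addr0 Ae ATe.
- by case: (split_ordP i) => i' ->; rewrite ?block_mxEul ?block_mxEdr mxE.
case: (split_ordP i) => i' ->; case: (split_ordP j) => j' ->;
  case: (split_ordP k) => k' ->;
  by rewrite ?(block_mxEul, block_mxEdr) !(mxE, mul0r, mulr0).
Qed.

Lemma bipartite_max_entry d (A : 'M[R]_d) a : 0 <= a ->
  max_entry A a -> max_entry (block_mx 0 A A^T 0) a.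
Proof.
move=> a0 [[i [j Aij]] Ale]; split.
  by exists (lshift d i), (rshift d j); rewrite block_mxEur.
move=> i' j'; case: (split_ordP i') => i'' ->; case: (split_ordP j') => j'' ->.
all: by rewrite ?(block_mxEul, block_mxEur, block_mxEdl, block_mxEdr) ?mxE.
Qed.

(** For q = v^T v this is the Householder reflection with mirror the hyperplane
    orthogonal to v. *)
Definition reflection {d} (v : 'cV[R]_d) (q : R) : 'M[R]_d :=
  1%:M - (2 / q) *: (v *m v^T).

Lemma reflection_entry d (v : 'cV[R]_d) q i j :
  reflection v q i j = (i == j)%:R - 2 / q * (v i 0 * v j 0).
Proof. by rewrite !mxE big_ord1 mxE. Qed.

Lemma reflection_orthogonal d (v : 'cV[R]_d) q :
  q != 0 -> v^T *m v = q%:M -> orthogonal_mx (reflection v q).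
Proof.
move=> q0 vv.
have symP : (reflection v q)^T = reflection v q.
  apply/matrixP => i j.
  by rewrite mxE !reflection_entry eq_sym [v j 0 * _]mulrC.
rewrite /orthogonal_mx symP /reflection mulmxBl !mulmxBr !mul1mx !mulmx1.
rewrite -scalemxAl -scalemxAr mulmxA -(mulmxA v) vv mul_mx_scalar -scalemxAl.
rewrite !scalerA; apply/matrixP => i j; rewrite !mxE; field; exact: q0.
Qed.

Lemma reflection_ones d (v : 'cV[R]_d) q :
  v^T *m @ones R d = 0 -> reflection v q *m @ones R d = @ones R d.
Proof.
by move=> ve; rewrite mulmxBl mul1mx -scalemxAl -mulmxA ve mulmx0 scaler0 subr0.
Qed.

End Bipartite.

Section Family.
Context {R : realType} (k : nat).
Hypothesis k_gt0 : (0 < k)%N.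

(** Chosen orthogonal to the all-ones vector, so that the reflection fixes it,
    with s the smallest of the absolute values of the entries for 0 < s <= 1:
    then the largest entry of the reflection is 1 - 2 s^2 / |v|^2, which is less
    than 1 and determines s. *)
Definition mirror (s : R) : 'cV[R]_k.+2 :=
  \col_i if i == 0 then s else if i == ord_max then - (s + k%:R) else 1.

Definition mirror_norm (s : R) : R := s ^+ 2 + k%:R + (s + k%:R) ^+ 2.

Let kR : 1 <= k%:R :> R. Proof. by rewrite ler1n. Qed.

Let mirror_sum (F : R -> R) s :
  \sum_i F (mirror s i 0) = F s + F 1 *+ k + F (- (s + k%:R)).
Proof.
rewrite big_ord_recl big_ord_recr /= addrA !mxE /=; congr (_ + _ + _).
  rewrite (eq_bigr (fun=> F 1)) ?sumr_const ?card_ord // => i _.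
  by rewrite !mxE -[_ == ord_max]val_eqE /= eqSS ltn_eqF.
by rewrite -[_ == ord_max]val_eqE /= eqxx.
Qed.

Let mirror_ones s : (mirror s)^T *m @ones R k.+2 = 0.
Proof.
apply/matrixP => i j; rewrite !ord1 !mxE.
under eq_bigr => l _ do rewrite mxE [ones R _ _ _]mxE mulr1.
by rewrite (mirror_sum id) /= opprD; ring.
Qed.

Let mirror_dot s : (mirror s)^T *m mirror s = (mirror_norm s)%:M.
Proof.
apply/matrixP => i j; rewrite !ord1 !mxE eqxx mulr1n.
under eq_bigr => l _ do rewrite mxE -expr2.
by rewrite (mirror_sum (fun x => x ^+ 2)) /mirror_norm; ring.
Qed.

Let mirror_norm_gt0 s : 0 < s -> 0 < mirror_norm s.
Proof.
move=> s0; have := sqr_ge0 s; have : 0 < (s + k%:R) ^+ 2.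
  by rewrite exprn_gt0 // (lt_le_trans s0) // lerDl ler0n.
by rewrite /mirror_norm; have := kR; lra.
Qed.

Let mirror_max_entry s : 0 < s <= 1 ->
  max_entry (reflection (mirror s) (mirror_norm s))
    (1 - 2 / mirror_norm s * s ^+ 2).
Proof.
move=> /andP[s0 s1]; have q0 := mirror_norm_gt0 _ s0; split.
  by exists 0, 0; rewrite reflection_entry !mxE /= expr2.
have key : 2 * (s + k%:R) <= mirror_norm s - 2 * s ^+ 2.
  rewrite -subr_ge0 (_ : _ - _ = (k%:R - 1) * (k%:R + 2 * s)).
    by rewrite mulr_ge0 ?subr_ge0 ?addr_ge0 ?mulr_ge0 ?ler0n ?(ltW s0).
  by rewrite /mirror_norm; ring.
move=> i j; rewrite reflection_entry.
have [<-|ij] := eqVneq i j; last first.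
  suff h : - (mirror s i 0 * mirror s j 0) <= s + k%:R.
    have -> : 1 - 2 / mirror_norm s * s ^+ 2 =
        (mirror_norm s - 2 * s ^+ 2) / mirror_norm s.
      by field; rewrite gt_eqF.
    rewrite mulr0n sub0r ler_pdivlMr // (le_trans _ key) //.
    rewrite (_ : _ * _ = - 2 * (mirror s i 0 * mirror s j 0)); first lra.
    by field; rewrite gt_eqF.
  (* The extreme product is that of the entries 1 and - (s + k). *)
  have sk : s * (s + k%:R) <= s + k%:R.
    by rewrite ler_piMl // addr_ge0 ?ler0n // ltW.
  have := kR; rewrite !mxE.
  have [i0|_] := eqVneq i 0; have [j0|_] := eqVneq j 0.
  - by rewrite i0 j0 eqxx in ij.
  - case: ifP => _; lra.
  - case: ifP => _; lra.
  - have [i1|_] := eqVneq i ord_max; have [j1|_] := eqVneq j ord_max; try lra.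
    by rewrite i1 j1 eqxx in ij.
rewrite lerD2l lerN2 ler_pM2l ?divr_gt0 // -expr2 mxE.
case: ifP => // _; case: ifP => _.
  rewrite sqrrN lerXn2r ?nnegrE ?lerDl ?ler0n ?addr_ge0 ?ler0n // ltW //.
by rewrite expr1n exprn_ile1 // ltW.
Qed.

(** Cross-multiplied, the equation says that (s - t) times a positive number
    is zero. *)
Let mirror_ratio_inj s t : 0 < s -> 0 < t ->
  2 / mirror_norm s * s ^+ 2 = 2 / mirror_norm t * t ^+ 2 -> s = t.
Proof.
move=> s0 t0 e; have q0 := mirror_norm_gt0 _ s0.
have r0 := mirror_norm_gt0 _ t0.
have {}e : s ^+ 2 * mirror_norm t = t ^+ 2 * mirror_norm s.
  transitivity
    (2 / mirror_norm s * s ^+ 2 * (mirror_norm s * mirror_norm t / 2)).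
    by field; rewrite gt_eqF.
  by rewrite e; field; rewrite gt_eqF.
have /eqP : (s - t) * ((s + t) * (k%:R + k%:R ^+ 2) + 2 * s * t * k%:R) = 0.
  transitivity (s ^+ 2 * mirror_norm t - t ^+ 2 * mirror_norm s).
    by rewrite /mirror_norm; ring.
  by rewrite e subrr.
rewrite mulf_eq0 subr_eq0 => /orP[/eqP //|]; rewrite gt_eqF //.
have k0 : 0 < k%:R :> R by rewrite ltr0n.
by rewrite addr_gt0 ?mulr_gt0 ?addr_gt0 ?exprn_gt0.
Qed.

(** The admissible matrices built from the reflections along mirror s have
    distinct largest entries, hence distinct permutation classes. *)
Lemma card_itv_le_perm_classes :
  ([set s : R | 0 < s <= 1] #<=
   @perm_class R (2 * k.+2) @`
     [set O | admissible O /\ forall i j, O i j <> 1]%classic)%card.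
Proof.
have /choice[O OE] : forall s : R, exists O : 'M[R]_(2 * k.+2), 0 < s <= 1 ->
    admissible O /\ max_entry O (1 - 2 / mirror_norm s * s ^+ 2).
  move=> s; rewrite mul2n -addnn.
  have [s01|] := boolP (0 < s <= 1); last by exists 0.
  pose A := reflection (mirror s) (mirror_norm s).
  exists (block_mx 0 A A^T 0) => _.
  have /andP[s0 s1] := s01; have q0 := mirror_norm_gt0 _ s0; split.
    apply: bipartite_admissible; last exact: reflection_ones.
    by apply: reflection_orthogonal => //; rewrite gt_eqF.
  apply: bipartite_max_entry; last exact: mirror_max_entry.
  have [_ /(_ 0 ord_max)] := mirror_max_entry _ s01; apply: le_trans.
  rewrite reflection_entry !mxE /= eqxx sub0r mulrN mulrN opprK.
  by rewrite !mulr_ge0 ?addr_ge0 ?ler0n ?invr_ge0 // ltW.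
apply: (card_le_inj _ _ (fun s => perm_class (O s))).
  move=> s s01; have [Oadm [_ Ole]] := OE s s01.
  exists (O s) => //; split=> // i j Oij.
  have /andP[s0 _] := s01.
  have := Ole i j; rewrite Oij lerBrDr gerDl leNgt.
  by rewrite mulr_gt0 ?divr_gt0 ?mirror_norm_gt0 ?exprn_gt0.
move=> s t; rewrite !inE => s01 t01 /perm_class_eqP st.
have [_ Os] := OE s s01; have [_ Ot] := OE t t01.
have /andP[s0 _] := s01; have /andP[t0 _] := t01.
have /addrI/oppr_inj/mirror_ratio_inj :=
  max_entry_perm_class _ _ _ _ _ st Os Ot.
exact.
Qed.

End Family.

(** * The two bijections *)

(* First conjunct: the bijection between orbits of sets and matrices.
   Second conjunct: the explicit Gram-matrix correspondence behind it.  A set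
   carries no order, so its matrix is determined only up to a simultaneous
   permutation of rows and columns, and an entry 1 would mean two equal points. *)
Theorem theorem1p3 (R : realType) (n : nat) (hn : (2 <= n)%N) :
  (exists f : set (set 'rV[R]_n) -> 'M[R]_(2 * n.+1),
     set_bij (@max_obtuse_orbits R n) [set O | admissible O] f)
  /\
  (exists g : set (set 'rV[R]_n) -> set 'M[R]_(2 * n.+1),
     set_bij (@max_obtuse_orbits R n)
       (@perm_class R (2 * n.+1) @`
          [set O | admissible O /\ forall i j, O i j <> 1]) g
     /\ forall (S : set 'rV[R]_n) (x : 'I_(2 * n.+1) -> 'rV[R]_n),
          max_obtuse S -> enumerates x S ->
          g (orth_orbit S) = perm_class (assoc_mx x)).
Proof.
have n_gt0 : (0 < n)%N by exact: ltnW.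
have bij_class := @orbit_class_bij R n n_gt0; split; last first.
  by exists orbit_class; split=> // S x; exact: orbit_classE.
have card_orbits : (@max_obtuse_orbits R n #= @perm_class R (2 * n.+1) @`
    [set O | admissible O /\ forall i j, O i j <> 1])%card.
  by apply/(card_eq_set_bij _ _ set0); exists orbit_class.
(* No particular bijection is asked for, so comparing cardinals is enough. *)
apply/(card_eq_set_bij _ _ (0 : 'M_(2 * n.+1))); apply: Cantor_Bernstein.
  rewrite (card_le_eql card_orbits); apply: card_le_trans (card_image_le _ _) _.
  by apply: subset_card_le => O [].
rewrite (card_le_eqr card_orbits).
apply: card_le_trans (card_leT _) _.
apply: card_le_trans (card_mx_le_set_nat _ _) _.
apply: card_le_trans (@card_set_nat_le_itv R) _.
case: n hn {n_gt0 bij_class card_orbits} => // k.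
exact: card_itv_le_perm_classes.
Qed.
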